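(* Let $\mathbf{X}=(X_1,\ldots,X_d)$ be a random vector with values in $\mathcal{X}_1\times\cdots\times\mathcal{X}_d$ whose components $X_1,\ldots,X_d$ are mutually independent, let $\eta:\mathcal{X}_1\times\cdots\times\mathcal{X}_d\to\mathcal{Y}$ be a measurable function (the model, taken in the setting of the classical functional ANOVA decomposition), and let $Y=\eta(\mathbf{X})$. Let $k_{\mathcal{Y}}$ be a positive definite kernel on $\mathcal{Y}$ such that for every $A\subseteq\{1,\ldots,d\}$ and every $\mathbf{x}_A\in\mathcal{X}_A$, $\mathbb{E}_{\xi\sim \mathrm{P}_{Y\mid \mathbf{X}_A=\mathbf{x}_A}} k_{\mathcal{Y}}(\xi,\xi)<\infty$ (with the convention $\mathrm{P}_{Y\mid \mathbf{X}_\emptyset}=\mathrm{P}_Y$). Define $\mathrm{MMD}^2_{\mathrm{tot}}=\mathbb{E}\,k_{\mathcal{Y}}(Y,Y)-\mathbb{E}\,k_{\mathcal{Y}}(Y,Y')$, where $Y'$ is an independent copy of $Y$. Then $$\mathrm{MMD}^2_{\mathrm{tot}}=\sum_{A\subseteq\{1,\ldots,d\}}\mathrm{MMD}^2_A,\qquad \mathrm{MMD}^2_A=\sum_{B\subseteq A}(-1)^{|A|-|B|}\,\mathbb{E}_{\mathbf{X}_B}\Big(\mathrm{MMD}^2\big(\mathrm{P}_Y,\mathrm{P}_{Y\mid \mathbf{X}_B}\big)\Big).$$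
   Context: For $A=\{l_1,\ldots,l_{|A|}\}\subseteq\{1,\ldots,d\}$, $\mathbf{X}_A=(X_{l_1},\ldots,X_{l_{|A|}})\in\mathcal{X}_A=\mathcal{X}_{l_1}\times\cdots\times\mathcal{X}_{l_{|A|}}$ and $\mathrm{P}_{Y\mid\mathbf{X}_A}$ denotes the conditional distribution of $Y$ given $\mathbf{X}_A$. For probability measures $\mathrm{P},\mathrm{Q}$ on $\mathcal{Y}$, the squared maximum mean discrepancy is $\mathrm{MMD}^2(\mathrm{P},\mathrm{Q})=\mathbb{E}\,k_{\mathcal{Y}}(\xi,\xi')-2\,\mathbb{E}\,k_{\mathcal{Y}}(\xi,\zeta)+\mathbb{E}\,k_{\mathcal{Y}}(\zeta,\zeta')$ with $\xi,\xi'\sim\mathrm{P}$, $\zeta,\zeta'\sim\mathrm{Q}$ all independent; equivalently it is the squared RKHS distance between the kernel mean embeddings of $\mathrm{P}$ and $\mathrm{Q}$. $\mathbb{E}_{\mathbf{X}_B}(\mathrm{MMD}^2(\mathrm{P}_Y,\mathrm{P}_{Y\mid\mathbf{X}_B}))$ is the expectation over $\mathbf{X}_B$ of the MMD between $\mathrm{P}_Y$ and the conditional law of $Y$ given $\mathbf{X}_B$; for $B=\emptyset$ it equals $0$. The sum over $B\subseteq A$ includes $B=\emptyset$ and $B=A$. *)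

(* Defs.v *)
From HB Require Import structures.
From mathcomp Require Import all_boot all_order all_algebra.
From mathcomp Require Import all_classical all_reals all_analysis.
From mathcomp Require Import measurable_realfun.
Set Implicit Arguments. Unset Strict Implicit. Unset Printing Implicit Defensive.
Import Order.TTheory GRing.Theory Num.Theory.
Local Open Scope classical_set_scope.
Local Open Scope ring_scope.

Definition prod_sigma (d : nat) (dT : 'I_d -> measure_display)
    (T : forall i, measurableType (dT i)) : set (set (forall i, T i)) :=
  <<s [set G | exists (i : 'I_d) (S : set (T i)),
                 measurable S /\ G = [set x | S (x i)]] >>.

Definition prod_measurable_fun (d : nat) (dT : 'I_d -> measure_display)
    (T : forall i, measurableType (dT i)) (dY : measure_display)
    (Ys : measurableType dY) (eta : (forall i, T i) -> Ys) : Prop :=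
  forall U : set Ys, measurable U -> @prod_sigma d dT T (eta @^-1` U).

Definition sigmaX (dO : measure_display) (Omega : measurableType dO)
    (d : nat) (dT : 'I_d -> measure_display) (T : forall i, measurableType (dT i))
    (X : forall i, Omega -> T i) (B : {set 'I_d}) : set (set Omega) :=
  <<s [set G | exists (i : 'I_d) (S : set (T i)),
                 [/\ i \in B, measurable S & G = X i @^-1` S]] >>.

Definition mutually_independent (R : realType) (dO : measure_display)
    (Omega : measurableType dO) (P : probability Omega R)
    (d : nat) (dT : 'I_d -> measure_display) (T : forall i, measurableType (dT i))
    (X : forall i, Omega -> T i) : Prop :=
  forall (B : {set 'I_d}) (S : forall i, set (T i)),
    (forall i, measurable (S i)) ->
    P [set w | forall i, i \in B -> S i (X i w)] =
    (\prod_(i in B) P (X i @^-1` S i))%E.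

Definition pd_kernel (R : realType) (Ys : Type) (k : Ys -> Ys -> R) : Prop :=
  (forall x y, k x y = k y x) /\
  (forall (n : nat) (y : 'I_n -> Ys) (c : 'I_n -> R),
     0 <= \sum_(i < n) \sum_(j < n) c i * c j * k (y i) (y j)).

Definition MMD2 (R : realType) (dY : measure_display) (Ys : measurableType dY)
    (k : Ys -> Ys -> R) (P Q : set Ys -> \bar R) : \bar R :=
  ((\int[P]_x \int[P]_y (k x y)%:E)
   - 2%:E * (\int[P]_x \int[Q]_z (k x z)%:E)
   + (\int[Q]_z \int[Q]_w (k z w)%:E))%E.

Definition is_cond_law (R : realType) (dO : measure_display)
    (Omega : measurableType dO) (P : probability Omega R)
    (d : nat) (dT : 'I_d -> measure_display) (T : forall i, measurableType (dT i))
    (X : forall i, Omega -> T i) (dY : measure_display) (Ys : measurableType dY)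
    (Y : Omega -> Ys) (B : {set 'I_d}) (kap : Omega -> probability Ys R) : Prop :=
  (forall U : set Ys, measurable U ->
     forall V : set (\bar R), measurable V ->
       sigmaX X B ((fun w => kap w U) @^-1` V)) /\
  (forall G : set Omega, sigmaX X B G ->
     forall U : set Ys, measurable U ->
       P (G `&` Y @^-1` U) = (\int[P]_(w in G) kap w U)%E).

(* Main.v *)
Require Import Defs.
From HB Require Import structures.
From mathcomp Require Import all_boot all_order all_algebra.
From mathcomp Require Import all_classical all_reals all_analysis.
From mathcomp Require Import measurable_realfun giry lra.
Set Implicit Arguments. Unset Strict Implicit. Unset Printing Implicit Defensive.
Import Order.TTheory GRing.Theory Num.Theory.
Local Open Scope classical_set_scope.
Local Open Scope ring_scope.

(* Moebius inversion over the subsets of {1..d} collapses the double sum to its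
   term at B = {1..d}, provided every E MMD^2(P_Y, P_{Y|X_B}) is finite. That
   follows from |k x y| <= k x x + k y y and E k(Y,Y) < oo, the latter being the
   moment hypothesis at A = set0. Averaging P_{Y|X_B} over X_B gives P_Y, so
   each such term equals E k(xi,xi') - E k(Y,Y'), with xi, xi' conditionally
   independent of law P_{Y|X_B}. For B = {1..d} the mixture over w of the
   products P_{Y|X=X(w)} x P_{Y|X=X(w)} agrees on rectangles, hence everywhere,
   with the law of (Y,Y), and the first term is E k(Y,Y). *)

(** * Moebius inversion on the lattice of subsets *)

Lemma alternating_sum_supersets (R : comPzRingType) (I : finType)
    (B : {set I}) :
  \sum_(A : {set I} | B \subset A) (-1) ^+ (#|A| - #|B|) = (B == finset.setT)%:R :> R.
Proof.
(* Expand \prod_i (F i + G i), whose factors are 1 on B and 0 off B. *)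
pose F i : R := if i \in B then 1 else -1.
pose G i : R := if i \in B then 0 else 1.
transitivity (\prod_i (F i + G i)); last first.
  have [BT|BT] := eqVneq B finset.setT.
    by apply: big1 => i _; rewrite /F /G BT finset.inE addr0.
  have [i iB] : exists i, i \notin B.
    apply/existsP; apply: contraR BT; rewrite negb_exists => /forallP BT.
    by apply/eqP/setP => i; rewrite finset.inE; have := BT i; rewrite negbK.
  by rewrite (bigD1 i)//= /F /G (negbTE iB) addNr mul0r.
rewrite bigA_distr big_mkcond/=; apply: eq_bigr => A _.
case: ifPn => BA; last first.
  have [i iB iA] := fintype.subsetPn BA.
  by rewrite (bigD1 i)//= (negbTE iA) /G iB mul0r.
rewrite -cardsDS// -prodr_const big_mkcond/=; apply: eq_bigr => i _.
rewrite finset.inE /F /G; have := fintype.subsetP BA i.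
by case: (i \in B); case: (i \in A) => //= /(_ isT).
Qed.

(** After exchanging the two sums, the coefficient of [f B] is the alternating sum over the
    supersets of [B], which vanishes unless [B] is the full set. *)
Lemma moebius_sum_subsets (R : comPzRingType) (I : finType)
    (f : {set I} -> R) :
  \sum_(A : {set I}) \sum_(B : {set I} | B \subset A)
    (-1) ^+ (#|A| - #|B|) * f B = f finset.setT.
Proof.
rewrite (exchange_big_dep xpredT)//=.
under eq_bigr do rewrite -mulr_suml alternating_sum_supersets.
rewrite (bigD1 finset.setT)//= eqxx mul1r big1 ?addr0// => B /negbTE ->.
by rewrite mul0r.
Qed.

(** * Pointwise bounds for positive definite kernels *)

Lemma pd_kernel_diag_ge0 (R : realType) (U : Type) (k : U -> U -> R) :
  pd_kernel k -> forall x, 0 <= k x x.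
Proof.
move=> [_ k_pd] x; have := k_pd 1%N (fun=> x) (fun=> 1).
by rewrite !big_ord1 !mul1r.
Qed.

(** Positivity at the points x, y with weights (1, 1) and (1, -1) gives 2 |k x y| <= k x x + k y y,
    and the nonnegative diagonal lets the factor 2 be dropped. The bound separates the variables, so
    integrals of [k] over a product are controlled by the marginals. *)
Lemma pd_kernel_norm_le (R : realType) (U : Type) (k : U -> U -> R) :
  pd_kernel k -> forall x y, `|k x y| <= k x x + k y y.
Proof.
move=> pk x y.
have [kC k_pd] := pk.
have kx := pd_kernel_diag_ge0 pk x; have ky := pd_kernel_diag_ge0 pk y.
pose p (i : 'I_2) := if i == ord0 then x else y.
have := k_pd 2%N p (fun=> 1).
have := k_pd 2%N p (fun i => if i == ord0 then 1 else -1).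
rewrite !big_ord_recl !big_ord0 /p /= (kC y x) => H1 H2.
by rewrite ler_norml; apply/andP; split; lra.
Qed.

(** * Uniqueness of measures on products, and integration against mixtures *)

Local Open Scope ereal_scope.

(** Rectangles form a generating pi-system that contains the whole space, and elements of [giry]
    have mass at most 1. *)
Lemma measure_eq_rectangles d1 d2 (T1 : measurableType d1)
    (T2 : measurableType d2) (R : realType) (m1 m2 : giry (T1 * T2)%type R) :
  (forall A B, measurable A -> measurable B -> m1 (A `*` B) = m2 (A `*` B)) ->
  forall E, measurable E -> m1 E = m2 E.
Proof.
move=> m12; apply: (measure_unique
    [set A1 `*` A2 | A1 in measurable & A2 in measurable] (fun=> setT)).
- exact: measurable_prod_measurableType.
- move=> _ _ [A1 mA1 [A2 mA2 <-]] [B1 mB1 [B2 mB2 <-]].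
  exists (A1 `&` B1); first exact: measurableI.
  exists (A2 `&` B2); first exact: measurableI.
  by rewrite setXI.
- by move=> _; exists setT => //; exists setT => //; rewrite setXTT.
- by rewrite bigcup_const.
- by move=> _ [A mA [B mB <-]]; exact: m12.
- by move=> _; rewrite (le_lt_trans (@sprobability_setT _ _ _ m1))// ltry.
Qed.

Section giry_bind_integrable.
Context d1 d2 (T1 : measurableType d1) (T2 : measurableType d2) (R : realType).
Variables (mu : giry T1 R) (K : T1 -> giry T2 R).
Hypothesis mK : measurable_fun setT K.
Variable f : T2 -> \bar R.
Hypothesis intf : (giry_bind mu mK).-integrable setT f.

Let mf : measurable_fun setT f. Proof. exact: measurable_int intf. Qed.

Let integrable_ge0 (g : T2 -> \bar R) :
  measurable_fun setT g -> (forall x, 0 <= g x) ->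
  (giry_bind mu mK).-integrable setT g ->
  mu.-integrable setT (fun w => \int[K w]_y g y).
Proof.
move=> mg g0 /integrableP[_ gfin]; apply/integrableP; split.
  exact: measurableT_comp (measurable_giry_int mg g0) mK.
under eq_integral do rewrite gee0_abs ?integral_ge0//.
by rewrite -[ltLHS](giry_int_bind mu mK mg g0) /giry_int;
  under eq_integral do rewrite -(gee0_abs (g0 _)).
Qed.

Let mfp : measurable_fun setT f^\+. Proof. exact: measurable_funepos. Qed.
Let mfn : measurable_fun setT f^\-. Proof. exact: measurable_funeneg. Qed.

Let intp : mu.-integrable setT (fun w => \int[K w]_y f^\+ y).
Proof. by apply: integrable_ge0 => //; exact: integrable_funepos. Qed.

Let intn : mu.-integrable setT (fun w => \int[K w]_y f^\- y).
Proof. by apply: integrable_ge0 => //; exact: integrable_funeneg. Qed.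

Lemma integrable_giry_bind : mu.-integrable setT (fun w => \int[K w]_y f y).
Proof.
under eq_fun do rewrite integralE.
exact: integrableB.
Qed.

(** The nonnegative case is [giry_int_bind]. It is applied to [f^\+] and [f^\-], whose inner
    integrals are [mu]-integrable by [intp] and [intn], so their difference integrates term by
    term. *)
Lemma integral_giry_bind :
  \int[giry_bind mu mK]_y f y = \int[mu]_w \int[K w]_y f y.
Proof.
under [RHS]eq_integral do rewrite integralE.
rewrite integralB// [LHS]integralE; congr (_ - _).
  by rewrite -[LHS]/(giry_int _ _) giry_int_bind.
by rewrite -[LHS]/(giry_int _ _) giry_int_bind.
Qed.

End giry_bind_integrable.

(** * Mixtures of product measures *)

Section mixture_of_products.
Context d1 d2 (T1 : measurableType d1) (T2 : measurableType d2) (R : realType).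
Variables (f : T1 * T2 -> \bar R) (h1 : T1 -> \bar R) (h2 : T2 -> \bar R).
Hypotheses (mf : measurable_fun setT f) (mh1 : measurable_fun setT h1)
  (mh2 : measurable_fun setT h2).
Hypotheses (h1_ge0 : forall x, 0 <= h1 x) (h2_ge0 : forall x, 0 <= h2 x).
Hypothesis f_le : forall x y, `|f (x, y)| <= h1 x + h2 y.

(** Each term of the bound [f_le] depends on one variable only; integrating out the other one
    multiplies it by a mass that is at most 1. *)
Lemma le_integral_giry_prod (m1 : giry T1 R) (m2 : giry T2 R) :
  \int[giry_prod (m1, m2)]_z `|f z| <= \int[m1]_x h1 x + \int[m2]_y h2 y.
Proof.
have mg1 : measurable_fun setT (fun z : T1 * T2 => h1 z.1).
  exact: measurableT_comp.
have mg2 : measurable_fun setT (fun z : T1 * T2 => h2 z.2).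
  exact: measurableT_comp.
apply: (@le_trans _ _ (\int[giry_prod (m1, m2)]_z (h1 z.1 + h2 z.2))).
  apply: ge0_le_integral => //.
  - exact: measurableT_comp.
  - exact: emeasurable_funD.
  - by move=> [x y] _; exact: f_le.
rewrite ge0_integralD//; apply: leeD.
- rewrite -[leLHS]/(giry_int _ _) giry_int_prod1// /giry_int/=.
  apply: ge0_le_integral => //.
  + by move=> x _; exact: integral_ge0.
  + exact: (measurable_fun_fubini_tonelli_F (fun z : T1 * T2 => h1 z.1)).
  + move=> x _; rewrite integral_cst// -[leRHS]mule1.
    by apply: lee_pmul => //; exact: sprobability_setT.
- rewrite -[leLHS]/(giry_int _ _) giry_int_prod2// /giry_int/=.
  apply: ge0_le_integral => //.
  + by move=> x _; exact: integral_ge0.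
  + exact: (measurable_fun_fubini_tonelli_G (fun z : T1 * T2 => h2 z.2)).
  + move=> x _; rewrite integral_cst// -[leRHS]mule1.
    by apply: lee_pmul => //; exact: sprobability_setT.
Qed.

Lemma integral_giry_prod (m1 : giry T1 R) (m2 : giry T2 R) :
  \int[m1]_x h1 x < +oo -> \int[m2]_y h2 y < +oo ->
  \int[giry_prod (m1, m2)]_z f z = \int[m1]_x \int[m2]_y f (x, y).
Proof.
move=> fin1 fin2; symmetry; apply: integral12_prod_meas1; apply/integrableP.
split => //; apply: le_lt_trans (le_integral_giry_prod m1 m2) _.
exact: lte_add_pinfty.
Qed.

Context d0 (T0 : measurableType d0).
Variable mu : giry T0 R.

Section one_mixture.
Variables (K1 : T0 -> giry T1 R) (K2 : T0 -> giry T2 R).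
Hypotheses (mK1 : measurable_fun setT K1) (mK2 : measurable_fun setT K2).

Lemma measurable_giry_prod_pair :
  measurable_fun setT (fun w => giry_prod (K1 w, K2 w)).
Proof.
by apply: measurableT_comp measurable_giry_prod _; exact: measurable_fun_pair.
Qed.

Let M : giry (T1 * T2)%type R := giry_bind mu measurable_giry_prod_pair.

Hypotheses (fin1 : forall w, \int[K1 w]_x h1 x < +oo)
  (fin2 : forall w, \int[K2 w]_y h2 y < +oo).
Hypotheses (Efin1 : \int[mu]_w \int[K1 w]_x h1 x < +oo)
  (Efin2 : \int[mu]_w \int[K2 w]_y h2 y < +oo).

(** Finiteness in mean ([Efin1], [Efin2]) gives integrability against the mixture; pointwise
    finiteness ([fin1], [fin2]) serves below to apply Fubini at each fixed [w]. *)
Let intf : M.-integrable setT f.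
Proof.
have mabs : measurable_fun setT (abse \o f) by exact: measurableT_comp.
have mE1 : measurable_fun setT (fun w => \int[K1 w]_x h1 x).
  exact: measurableT_comp (measurable_giry_int mh1 h1_ge0) mK1.
have mE2 : measurable_fun setT (fun w => \int[K2 w]_x h2 x).
  exact: measurableT_comp (measurable_giry_int mh2 h2_ge0) mK2.
have E1_ge0 w : 0 <= \int[K1 w]_x h1 x by exact: integral_ge0.
have E2_ge0 w : 0 <= \int[K2 w]_x h2 x by exact: integral_ge0.
apply/integrableP; split => //.
rewrite -[ltLHS]/(giry_int _ (abse \o f)) giry_int_bind//; last first.
  by move=> z; exact: abse_ge0.
apply: (@le_lt_trans _ _
    (\int[mu]_w (\int[K1 w]_x h1 x + \int[K2 w]_x h2 x))); last first.
  by rewrite ge0_integralD//; exact: lte_add_pinfty.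
apply: ge0_le_integral => //.
- by move=> w _; apply: integral_ge0 => z _; exact: abse_ge0.
- apply: measurableT_comp (measurable_giry_int mabs _)
    measurable_giry_prod_pair.
  by move=> z; exact: abse_ge0.
- exact: emeasurable_funD.
- by move=> w _; exact: le_integral_giry_prod.
Qed.

Lemma integrable_mixture :
  mu.-integrable setT (fun w => \int[K1 w]_x \int[K2 w]_y f (x, y)).
Proof.
under eq_fun do rewrite -integral_giry_prod//.
exact: integrable_giry_bind intf.
Qed.

Lemma integral_mixture :
  \int[mu]_w \int[K1 w]_x \int[K2 w]_y f (x, y) = \int[M]_z f z.
Proof.
under eq_integral do rewrite -integral_giry_prod//.
by rewrite -(integral_giry_bind intf).
Qed.

End one_mixture.

Lemma giry_bind_prod_rectangle (K1 : T0 -> giry T1 R) (K2 : T0 -> giry T2 R)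
    (mK1 : measurable_fun setT K1) (mK2 : measurable_fun setT K2) A B :
  measurable A -> measurable B ->
  giry_bind mu (measurable_giry_prod_pair mK1 mK2) (A `*` B) =
  \int[mu]_w (K1 w A * K2 w B).
Proof.
move=> mA mB; rewrite /giry_bind /=.
rewrite giry_int_map//; last by apply: measurable_giry_ev; exact: measurableX.
by apply: eq_integral => w _; rewrite /= -product_measure1E.
Qed.

(** Each side depends on its kernels only through the mixture of their products, and mixtures are
    compared on rectangles. Hence kernels that agree almost surely on each measurable set qualify,
    even when the null set varies with the set. *)
Lemma eq_integral_mixture (K1 K1' : T0 -> giry T1 R) (K2 K2' : T0 -> giry T2 R) :
  measurable_fun setT K1 -> measurable_fun setT K2 ->
  measurable_fun setT K1' -> measurable_fun setT K2' ->
  (forall w, \int[K1 w]_x h1 x < +oo) -> (forall w, \int[K2 w]_x h2 x < +oo) ->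
  (forall w, \int[K1' w]_x h1 x < +oo) -> (forall w, \int[K2' w]_x h2 x < +oo) ->
  \int[mu]_w \int[K1 w]_x h1 x < +oo -> \int[mu]_w \int[K2 w]_x h2 x < +oo ->
  \int[mu]_w \int[K1' w]_x h1 x < +oo -> \int[mu]_w \int[K2' w]_x h2 x < +oo ->
  (forall A B, measurable A -> measurable B ->
    \int[mu]_w (K1 w A * K2 w B) = \int[mu]_w (K1' w A * K2' w B)) ->
  \int[mu]_w \int[K1 w]_x \int[K2 w]_y f (x, y) =
  \int[mu]_w \int[K1' w]_x \int[K2' w]_y f (x, y).
Proof.
move=> mK1 mK2 mK1' mK2' f1 f2 f1' f2' e1 e2 e1' e2' KK'.
rewrite (integral_mixture mK1 mK2)// (integral_mixture mK1' mK2')//.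
apply: eq_measure_integral => E mE _; apply: measure_eq_rectangles => //.
by move=> A B mA mB; rewrite !giry_bind_prod_rectangle// KK'.
Qed.

End mixture_of_products.

(** * Integrals of constants and against image measures *)

Lemma probability_integral_cst d1 (T1 : measurableType d1) (R : realType)
    (P : probability T1 R) (c : \bar R) : \int[P]_w c = c.
Proof.
rewrite integral_cst// -[RHS]mule1; congr (_ * _).
by rewrite -(probability_setT P).
Qed.

Lemma integral_pushforward_measurable d1 d2 (T1 : measurableType d1)
    (T2 : measurableType d2) (R : realType) (mu : {measure set T1 -> \bar R})
    (phi : T1 -> T2) (f : T2 -> \bar R) :
  measurable_fun setT phi -> measurable_fun setT f ->
  \int[pushforward mu phi]_y f y = \int[mu]_x f (phi x).
Proof.
move=> mphi mf; rewrite [LHS]integralE [RHS]integralE.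
congr (_ - _).
- rewrite ge0_integral_pushforward//; last exact: measurable_funepos.
  by rewrite preimage_setT; apply: eq_integral => x _; rewrite /= !funeposE.
- rewrite ge0_integral_pushforward//; last exact: measurable_funeneg.
  by rewrite preimage_setT; apply: eq_integral => x _; rewrite /= !funenegE.
Qed.

(** * Sigma-algebras generated by subvectors of [X], and conditional laws *)

Section sigmaX.
Context (dO : measure_display) (Omega : measurableType dO)
  (d : nat) (dT : 'I_d -> measure_display) (T : forall i, measurableType (dT i)).
Variable X : forall i, Omega -> T i.

Lemma sigmaX_measurable (B : {set 'I_d}) :
  (forall i, measurable_fun setT (X i)) -> sigmaX X B `<=` measurable.
Proof.
move=> mX; apply: smallest_sub; first exact: sigma_algebra_measurable.
by move=> _ [i [S [_ mS ->]]]; rewrite -[X in measurable X]setTI; exact: mX.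
Qed.

(** With no index available the generating family is empty, so it suffices that the two trivial sets
    form a sigma-algebra. *)
Lemma sigmaX_set0 G : sigmaX X finset.set0 G -> G = set0 \/ G = setT.
Proof.
apply: (smallest_sub (X := [set G | G = set0 \/ G = setT])).
  split; first by left.
    by move=> _ [->|->]; [right; rewrite setD0|left; rewrite setDv].
  move=> F F01; have [[i Fi]|nF] := pselect (exists i, F i = setT).
    by right; apply/seteqP; split => // x _; exists i => //; rewrite Fi.
  left; rewrite -subset0 => x [i _]; have [->//|Fi] := F01 i.
  by exfalso; apply: nF; exists i.
by move=> G0 [i [S []]]; rewrite finset.inE.
Qed.

(** The sets with a good preimage form a sigma-algebra containing the cylinders. This is what makes
    [Y] measurable with respect to the whole vector [X]. *)
Lemma sigmaX_preimage (G : set (forall i, T i)) :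
  prod_sigma G -> sigmaX X finset.setT ((fun w i => X i w) @^-1` G).
Proof.
apply: (smallest_sub
    (X := [set G | sigmaX X finset.setT ((fun w i => X i w) @^-1` G)])).
  split => /=.
  - by rewrite preimage_set0; exact: sigma_algebra0.
  - by move=> A; rewrite setTD preimage_setC; exact: sigma_algebraC.
  - by move=> F mF; rewrite preimage_bigcup; exact: sigma_algebra_bigcup.
move=> _ [i [S [mS ->]]]; apply: sub_sigma_algebra.
by exists i, S; split => //; rewrite finset.inE.
Qed.

Context (R : realType) (P : probability Omega R) (dY : measure_display)
  (Ys : measurableType dY).
Variables (Y : Omega -> Ys) (B : {set 'I_d}) (kap : Omega -> probability Ys R).
Hypotheses (mX : forall i, measurable_fun setT (X i))
  (mY : measurable_fun setT Y).
Hypothesis kapP : is_cond_law P X Y B kap.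

Lemma measurable_cond_law U :
  measurable U -> measurable_fun setT (fun w => kap w U).
Proof.
move=> mU _ V mV; rewrite setTI; apply: (sigmaX_measurable (B := B)) => //.
exact: kapP.1.
Qed.

Lemma measurable_giry_cond_law :
  measurable_fun setT (fun w => kap w : giry Ys R).
Proof.
by apply: measurable_giry_codensity => // U mU; exact: measurable_cond_law.
Qed.

Lemma integral_cond_law U :
  measurable U -> \int[P]_w kap w U = pushforward P Y U.
Proof.
move=> mU; rewrite -kapP.2//; first by rewrite setTI.
by rewrite -setC0; apply: sigma_algebraC; exact: sigma_algebra0.
Qed.

(** Tower property: by [integral_cond_law], the mixture of the [kap w] under [P] is the law of
    [Y]. *)
Lemma integral_integral_cond_law (h : Ys -> \bar R) :
  measurable_fun setT h -> (forall y, 0 <= h y) ->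
  \int[P]_w \int[kap w]_y h y = \int[pushforward P Y]_y h y.
Proof.
move=> mh h0.
rewrite -[LHS](giry_int_bind (P : giry Omega R) measurable_giry_cond_law mh h0).
apply: eq_measure_integral => // U mU _.
rewrite -[RHS]/(pushforward P Y U) -integral_cond_law//.
by rewrite /giry_bind/= giry_int_map//; exact: measurable_giry_ev.
Qed.

(* If Y is itself sigma(X_B)-measurable, conditioning on X_B determines Y. The
   null set depends on U, and no countable generation of the sigma-algebra on
   Ys is available to make it uniform. *)
Lemma cond_law_ae_dirac U : sigmaX X B (Y @^-1` U) -> measurable U ->
  ae_eq P setT (fun w => kap w U) (fun w => \d_(Y w) U).
Proof.
move=> sU mU; set G := Y @^-1` U.
have sC : sigmaX X B (~` G) by exact: sigma_algebraC.
have mG : measurable G by exact: sigmaX_measurable sU.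
have mCG : measurable (~` G) by exact: measurableC.
have mCU : measurable (~` U) by exact: measurableC.
(* The mass that [kap w] gives to the complement of [U] integrates over [G] to the probability that
   [Y] lies both in [U] and outside it, which is 0; being nonnegative, it vanishes almost everywhere
   on [G]. [H2] is the symmetric fact off [G]. *)
have H1 : ae_eq P G (fun w => kap w (~` U)) (cst 0).
  apply/ae_eq_integral_abs => //.
    exact: measurable_funTS (measurable_cond_law _).
  under eq_integral do rewrite gee0_abs//.
  by rewrite -kapP.2// preimage_setC setICr measure0.
have H2 : ae_eq P (~` G) (fun w => kap w U) (cst 0).
  apply/ae_eq_integral_abs => //.
    exact: measurable_funTS (measurable_cond_law _).
  under eq_integral do rewrite gee0_abs//.
  by rewrite -kapP.2// setICl measure0.
apply: filterS2 H1 H2 => w H1 H2 _; rewrite diracE.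
have [/set_mem YU|/negP YU] := boolP (Y w \in U).
  have := H1 YU; rewrite /= probability_setC//.
  rewrite -(fineK (fin_num_measure (kap w) U mU)) -EFinB => -[] /eqP.
  by rewrite subr_eq0 => /eqP <-.
by rewrite H2//= => YU'; apply: YU; exact/mem_set.
Qed.

End sigmaX.

(** The preimage of the singleton of [kap w U] is a nonempty member of the trivial sigma-algebra,
    hence everything. So [kap] is constant on each [U] and equals its mean, at every [w] and not
    just almost surely. *)
Lemma cond_law_set0 (R : realType) (dO : measure_display)
    (Omega : measurableType dO) (P : probability Omega R)
    (d : nat) (dT : 'I_d -> measure_display)
    (T : forall i, measurableType (dT i)) (X : forall i, Omega -> T i)
    (dY : measure_display) (Ys : measurableType dY)
    (Y : Omega -> Ys) (kap : Omega -> probability Ys R) :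
  is_cond_law P X Y finset.set0 kap ->
  forall w U, measurable U -> kap w U = pushforward P Y U.
Proof.
move=> kapP w U mU; rewrite -(integral_cond_law kapP)//.
have cstk w' : kap w' U = kap w U.
  have := kapP.1 U mU [set kap w U] (emeasurable_set1 _).
  by move=> /sigmaX_set0[/seteqP[/(_ w erefl)]//|/seteqP[_ /(_ w' I)]].
under eq_integral do rewrite cstk.
by rewrite probability_integral_cst.
Qed.

Lemma measurable_diag d1 (T1 : measurableType d1) (R : realType)
    (k : T1 -> T1 -> R) :
  measurable_fun setT (fun p : T1 * T1 => k p.1 p.2) ->
  measurable_fun setT (fun y => (k y y)%:E).
Proof.
move=> mk; apply/measurable_EFinP.
have mdiag : measurable_fun setT (fun y : T1 => (y, y)).
  exact: measurable_fun_pair.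
exact: measurableT_comp mk mdiag.
Qed.

(** * The mean squared MMD for one conditioning set *)

Section mean_MMD2.
Context (R : realType) (dO : measure_display) (Omega : measurableType dO)
  (P : probability Omega R) (d : nat) (dT : 'I_d -> measure_display)
  (T : forall i, measurableType (dT i)) (X : forall i, Omega -> T i)
  (dY : measure_display) (Ys : measurableType dY) (Y : Omega -> Ys)
  (k : Ys -> Ys -> R).
Hypotheses (mX : forall i, measurable_fun setT (X i))
  (mY : measurable_fun setT Y).
Hypotheses (k_pd : pd_kernel k)
  (mk : measurable_fun setT (fun p : Ys * Ys => k p.1 p.2)).
Hypothesis diag_fin : \int[P]_w (k (Y w) (Y w))%:E < +oo.

Let f (p : Ys * Ys) : \bar R := (k p.1 p.2)%:E.
Let h (y : Ys) : \bar R := (k y y)%:E.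
Let PY : giry Ys R := giry_map mY (P : giry Omega R).

Let mf : measurable_fun setT f. Proof. exact/measurable_EFinP. Qed.

Let mh : measurable_fun setT h. Proof. exact: measurable_diag. Qed.

Let mf1 x : measurable_fun setT (fun y => f (x, y)).
Proof. exact: measurableT_comp mf (measurable_pair1 x). Qed.

Let h_ge0 y : 0 <= h y. Proof. by rewrite lee_fin pd_kernel_diag_ge0. Qed.

Let f_le x y : `|f (x, y)| <= h x + h y.
Proof. by rewrite -EFinD lee_fin pd_kernel_norm_le. Qed.

Let PYh_fin : \int[PY]_y h y < +oo.
Proof. by rewrite [ltLHS](integral_pushforward_measurable P mY mh). Qed.

Let PPYh_fin : \int[P]_w \int[PY]_y h y < +oo.
Proof. by rewrite probability_integral_cst. Qed.

Let mPY : measurable_fun setT (fun _ : Omega => PY).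
Proof. exact: measurable_cst. Qed.

Let fPY_integrable : (PY \x PY).-integrable setT f.
Proof.
apply/integrableP; split => //.
apply: le_lt_trans (le_integral_giry_prod mf mh mh h_ge0 h_ge0 f_le PY PY) _.
exact: lte_add_pinfty.
Qed.

Lemma integral_kernel_pushforward :
  \int[pushforward P Y]_x \int[pushforward P Y]_y (k x y)%:E =
  \int[P]_w \int[P]_w' (k (Y w) (Y w'))%:E.
Proof.
rewrite integral_pushforward_measurable//; last first.
  exact: (measurable_fubini_F fPY_integrable).
apply: eq_integral => w _; rewrite integral_pushforward_measurable//.
exact: mf1.
Qed.

(** E k(Y, Y') with Y' an independent copy of Y. *)
Let c := \int[PY]_x \int[PY]_y f (x, y).

Let c_fin : c \is a fin_num.
Proof.
have -> : c = \int[PY \x PY]_z f z by exact: integral12_prod_meas1.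
exact: integrable_fin_num.
Qed.

Section one_cond_law.
Variables (B : {set 'I_d}) (kap : Omega -> probability Ys R).
Hypothesis kapP : is_cond_law P X Y B kap.
Hypothesis kap_fin : forall w, \int[kap w]_y (k y y)%:E < +oo.

Let K w : giry Ys R := kap w.
Let mK : measurable_fun setT K.
Proof. exact: measurable_giry_cond_law kapP. Qed.

Let EK_fin : \int[P]_w \int[K w]_y h y < +oo.
Proof. by rewrite (integral_integral_cond_law mX mY kapP mh h_ge0). Qed.

Let q := \int[P]_w \int[K w]_x \int[K w]_y f (x, y).

Let q_int : P.-integrable setT (fun w => \int[K w]_x \int[K w]_y f (x, y)).
Proof. exact: (integrable_mixture mf mh mh h_ge0 h_ge0 f_le). Qed.

Let q_fin : q \is a fin_num. Proof. exact: integrable_fin_num q_int. Qed.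

Let cross_int : P.-integrable setT (fun w => \int[PY]_x \int[K w]_y f (x, y)).
Proof.
exact: (integrable_mixture mf mh mh h_ge0 h_ge0 f_le (K1 := fun=> PY)).
Qed.

(** One factor is the fixed law of [Y], so on a rectangle only the other factor is averaged over
    [w], and its mean is again the law of [Y]. *)
Let integral_cross : \int[P]_w \int[PY]_x \int[K w]_y f (x, y) = c.
Proof.
transitivity (\int[P]_w \int[PY]_x \int[PY]_y f (x, y)); last first.
  by rewrite probability_integral_cst.
apply: (eq_integral_mixture mf mh mh h_ge0 h_ge0 f_le (mu := P)
  (K1 := fun=> PY) (K1' := fun=> PY) (K2' := fun=> PY)) => //.
move=> A A' mA mA'.
rewrite [RHS]probability_integral_cst.
rewrite ge0_integralZl//; last exact: measurable_cond_law kapP _ _.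
by rewrite (integral_cond_law kapP).
Qed.

Lemma integral_MMD2 : \int[P]_w MMD2 k (pushforward P Y) (kap w) =
  \int[P]_w \int[kap w]_x \int[kap w]_y (k x y)%:E
  - \int[P]_w \int[P]_w' (k (Y w) (Y w'))%:E.
Proof.
rewrite -integral_kernel_pushforward.
have c_int : P.-integrable setT (fun=> c).
  by rewrite -(fineK c_fin); exact: finite_measure_integrable_cst.
rewrite /MMD2 integralD//; last first.
  by apply: integrableB => //; exact: integrableZl.
rewrite integralB//; last exact: integrableZl.
rewrite integralZl// integral_cross probability_integral_cst.
(* Both [c] and [q] are finite, so the identity c - 2c + q = q - c can be checked in the reals. *)
rewrite -[LHS]/(c - 2%:E * c + q) -[RHS]/(q - c) -(fineK c_fin) -(fineK q_fin).
by rewrite -EFinM -!EFinB -EFinD; congr EFin; lra.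
Qed.

Lemma integral_MMD2_fin_num :
  \int[P]_w MMD2 k (pushforward P Y) (kap w) \is a fin_num.
Proof.
rewrite integral_MMD2 -integral_kernel_pushforward fin_numB.
by apply/andP; split; [exact: q_fin|exact: c_fin].
Qed.

(** Inside the mixture, [kap w] may be replaced by the Dirac mass at [Y w]; the double Dirac
    integral then evaluates [k] on the diagonal. *)
Lemma integral_kernel_cond_law :
  (forall U, measurable U -> sigmaX X B (Y @^-1` U)) ->
  \int[P]_w \int[kap w]_x \int[kap w]_y (k x y)%:E =
  \int[P]_w (k (Y w) (Y w))%:E.
Proof.
move=> sY; pose D w : giry Ys R := giry_ret (Y w).
have mD : measurable_fun setT D.
  exact: measurableT_comp measurable_giry_ret mY.
have Dint g w : measurable_fun setT g -> \int[D w]_y g y = g (Y w).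
  by move=> mg; exact: giry_int_ret.
transitivity (\int[P]_w \int[D w]_x \int[D w]_y f (x, y)).
  apply: (eq_integral_mixture mf mh mh h_ge0 h_ge0 f_le (mu := P)
    (K1 := K) (K2 := K) (K1' := D) (K2' := D)) => //.
  - by move=> w; rewrite Dint// ltry.
  - by move=> w; rewrite Dint// ltry.
  - by under eq_integral do rewrite Dint//.
  - by under eq_integral do rewrite Dint//.
  - move=> A A' mA mA'.
    have mKU U : measurable U -> measurable_fun setT (fun w => K w U).
      exact: measurable_cond_law kapP _.
    have mDU U : measurable U -> measurable_fun setT (fun w => D w U).
      move=> mU; exact: measurableT_comp (measurable_giry_ev mU) mD.
    apply: ge0_ae_eq_integral => //.
    + by apply: emeasurable_funM; exact: mKU.
    + by apply: emeasurable_funM; exact: mDU.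
    + by move=> w _; exact: mule_ge0.
    + by move=> w _; exact: mule_ge0.
    (* The rectangle is fixed here, so only two null sets, one per side, have to be discarded. *)
    + have HA := cond_law_ae_dirac mX kapP (sY _ mA) mA.
      have HA' := cond_law_ae_dirac mX kapP (sY _ mA') mA'.
      by apply: filterS2 HA HA' => w HA HA' _; congr (_ * _);
        [exact: HA|exact: HA'].
apply: eq_integral => w _.
rewrite (eq_integral (fun x => f (x, Y w))).
  by rewrite Dint//; exact: measurableT_comp mf (measurable_pair2 (Y w)).
by move=> x _; rewrite (Dint (fun y => f (x, y))).
Qed.

End one_cond_law.
End mean_MMD2.

(* Assembly of the decomposition *)
Local Close Scope ereal_scope.

Theorem mainTheorem1 (R : realType) (dO : measure_display)
  (Omega : measurableType dO) (P : probability Omega R)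
  (d : nat) (dT : 'I_d -> measure_display) (T : forall i, measurableType (dT i))
  (X : forall i, Omega -> T i)
  (dY : measure_display) (Ys : measurableType dY)
  (eta : (forall i, T i) -> Ys) (k : Ys -> Ys -> R)
  (kap : {set 'I_d} -> Omega -> probability Ys R) :
  (forall i, measurable_fun setT (X i)) ->
  mutually_independent P X ->
  prod_measurable_fun eta ->
  pd_kernel k ->
  measurable_fun setT (fun p : Ys * Ys => k p.1 p.2) ->
  (forall A : {set 'I_d},
     is_cond_law P X (fun w => eta (fun i => X i w)) A (kap A)) ->
  (forall (A : {set 'I_d}) (w : Omega),
     (\int[kap A w]_y (k y y)%:E < +oo)%E) ->
  let Y := fun w => eta (fun i => X i w) in
  ((\int[P]_w (k (Y w) (Y w))%:E) - (\int[P]_w \int[P]_w' (k (Y w) (Y w'))%:E))%E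
  = (\sum_(A : {set 'I_d})
       \sum_(B : {set 'I_d} | B \subset A)
         ((-1) ^+ (#|A| - #|B|))%:E * (\int[P]_w MMD2 k (pushforward P Y) (kap B w)))%E.
Proof.
move=> mX _ meta k_pd mk kapP kap_fin Y.
have sY U : measurable U -> sigmaX X finset.setT (Y @^-1` U).
  by move=> mU; apply: (sigmaX_preimage (G := eta @^-1` U)); exact: meta.
have mY : measurable_fun setT Y.
  by move=> _ U mU; rewrite setTI; exact: sigmaX_measurable mX _ (sY _ mU).
have diag_fin : (\int[P]_w (k (Y w) (Y w))%:E < +oo)%E.
  (* [P] has mass 1, so some [w] exists. Since [cond_law_set0] holds at every point, [kap_fin] at
     this [w] bounds the integral of the diagonal against the law of [Y]. *)
  have [w _] : [set: Omega] !=set0.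
    apply/set0P/eqP => T0; have := probability_setT P.
    by rewrite T0 measure0 => /eqP; rewrite eqe eq_sym oner_eq0.
  have mh : measurable_fun setT (fun y => (k y y)%:E).
    exact: measurable_diag.
  rewrite -(integral_pushforward_measurable P mY mh).
  rewrite (eq_measure_integral (kap finset.set0 w)); first exact: kap_fin.
  by move=> U mU _; rewrite -[LHS](cond_law_set0 (kapP _) w mU).
pose m B := (\int[P]_w MMD2 k (pushforward P Y) (kap B w))%E.
have m_fin B : m B \is a fin_num.
  exact (integral_MMD2_fin_num mX mY k_pd mk diag_fin (kapP B) (kap_fin B)).
transitivity (m finset.setT).
  rewrite /m (integral_MMD2 mX mY k_pd mk diag_fin (kapP _) (kap_fin _)).
  by rewrite (integral_kernel_cond_law mX mY k_pd mk diag_fin (kapP _) (kap_fin _)).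
(* Moebius inversion lives in a ring, so the finite means [m B] are moved to the reals. *)
rewrite -(fineK (m_fin _)) -(moebius_sum_subsets (fun B => fine (m B))).
rewrite -sumEFin; apply: eq_bigr => A _; rewrite -sumEFin.
by apply: eq_bigr => B _; rewrite EFinM fineK.
Qed.
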